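(* Let $m,n\geq2$ be integers, let $k=\min\{m,n\}$, and let $A\in\mathbb{R}^{m\times n}$ with $A\leq0$ (all entries non-positive). The following statements are equivalent: (1) $A$ is totally non-positive. (2) For all $x\in\mathbb{R}^n_{+,-}$, $S^-(Ax)\leq S^-(x)$. Moreover, if equality occurs and $Ax\neq0$, then the first (last) nonzero component of $Ax$ has the same sign as the first (last) nonzero component of $x$. (3) For every square submatrix $A_r$ of $A$ of size $r\in[2,k]$, there is some $\alpha\in\mathbb{R}^r_{\mathrm{alt}}$ such that, with $y^{A_r}:=\operatorname{adj}(A_r)\alpha$, we have $S^-(A_ry^{A_r})\leq S^-(y^{A_r})$, and if equality occurs here and $A_ry^{A_r}\neq0$, then the first (last) nonzero component of $A_ry^{A_r}$ has the same sign as the first (last) nonzero component of $y^{A_r}$.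
   Context: A real $m\times n$ matrix is totally non-positive if all its minors of every order at most $\min\{m,n\}$ are non-positive. $\operatorname{adj}$ denotes the adjugate matrix; $[a,b]$ is the set of integers from $a$ to $b$. $\mathbb{R}^n_{+,-}$ is the set of vectors in $\mathbb{R}^n$ with at least one positive and at least one negative coordinate. $\mathbb{R}^r_{\mathrm{alt}}$ is the set of vectors in $\mathbb{R}^r$ whose coordinates are all nonzero and have alternating signs. For a real vector $x$, $S^-(x)$ is the number of sign changes in the sequence of coordinates of $x$ after removing all zero entries, with $S^-(0):=0$. ''First (last)'' means the assertion holds for the first nonzero components and also for the last nonzero components. *)

(* Defs.v *)
From mathcomp Require Import all_boot all_order all_algebra.
From mathcomp Require Import reals.
From mathcomp Require Import qe_rcf_th.

Set Implicit Arguments.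
Unset Strict Implicit.
Unset Printing Implicit Defensive.

Import Order.TTheory GRing.Theory Num.Theory.

Local Open Scope ring_scope.

(* A submatrix is [mxsub f g A] with [f] and [g] strictly increasing. *)
Definition increasing (r n : nat) (f : 'I_r -> 'I_n) : Prop :=
  forall i j : 'I_r, (i < j)%N -> (f i < f j)%N.

(* Order 0 is excluded: the empty minor equals 1. *)
Definition totally_nonpositive (R : rcfType) (m n : nat) (A : 'M[R]_(m, n)) : Prop :=
  forall (r : nat) (f : 'I_r -> 'I_m) (g : 'I_r -> 'I_n),
    (1 <= r <= minn m n)%N -> increasing f -> increasing g ->
    \det (mxsub f g A) <= 0.

Definition has_both_signs (R : rcfType) (n : nat) (x : 'cV[R]_n) : Prop :=
  (exists i, 0 < x i 0) /\ (exists i, x i 0 < 0).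

Definition alternating (R : rcfType) (r : nat) (a : 'cV[R]_r) : Prop :=
  (forall i, a i 0 != 0) /\
  (forall i j : 'I_r, j = i.+1 :> nat -> a i 0 * a j 0 < 0).

Definition nonzero_coords (R : rcfType) (n : nat) (x : 'cV[R]_n) : seq R :=
  [seq c <- [seq x i 0 | i <- enum 'I_n] | c != 0].

(* S^-(x); [changes] counts the consecutive pairs with negative product. *)
Definition sign_changes (R : rcfType) (n : nat) (x : 'cV[R]_n) : nat :=
  changes (nonzero_coords x).

(* The default value 0 is reached only when x = 0. *)
Definition first_nonzero (R : rcfType) (n : nat) (x : 'cV[R]_n) : R :=
  head 0 (nonzero_coords x).

Definition last_nonzero (R : rcfType) (n : nat) (x : 'cV[R]_n) : R :=
  last 0 (nonzero_coords x).

Definition variation_diminished (R : rcfType) (m n : nat)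
    (A : 'M[R]_(m, n)) (x : 'cV[R]_n) : Prop :=
  (sign_changes (A *m x) <= sign_changes x)%N /\
  (sign_changes (A *m x) = sign_changes x -> A *m x != 0 ->
     Num.sg (first_nonzero (A *m x)) = Num.sg (first_nonzero x) /\
     Num.sg (last_nonzero (A *m x)) = Num.sg (last_nonzero x)).

(* Main.v *)
Require Import Defs.
From mathcomp Require Import all_boot all_order all_algebra.
From mathcomp Require Import reals.
From mathcomp Require Import perm qe_rcf_th zify ring.

(** Write S for the number of sign changes.

    Why total non-positivity diminishes variation.  Let S(x) = p and group the
    coordinates of x into p + 1 consecutive blocks of constant weak sign.  Then
    x = W c, where c is an alternating vector of length p + 1 and W is a
    non-negative matrix whose nonzero pattern is a staircase of blocks.  By
    multilinearity every minor of A W is a non-negative combination of minors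
    of A, so A W is again totally non-positive ([tnp_mul_blocks]), and
    A x = (A W) c.  If S(A x) exceeded p, then p + 2 rows of A W would give a
    (p + 2) x (p + 1) totally non-positive matrix M with M c alternating,
    which is impossible ([tnp_alternating_image]).  If S(A x) = p, then
    p + 1 rows give a square matrix B with B c alternating.  Such a B is
    non-singular, and Cramer's rule for the first coordinate, in which all
    terms have a common sign, yields that B c and c start with the same sign
    ([tnp_alternating_square_sg]); its minors have order p, which is positive
    because x has both signs.  The sign of the last nonzero coordinate
    follows, since it is determined by the first one and by S.

    The impossibility is proved by induction on the number k of columns of M.
    If the top k x k block of M is singular, a kernel vector allows one
    coordinate of c to be cancelled, hence one column to be dropped, and the
    block falls under the induction hypothesis ([singular_drop_column]).
    Otherwise the signed maximal minors of M form a left null vector of M whose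
    pairing with the alternating vector M c has terms of one sign that are not
    all zero.

    Why the variation property for A gives the one for a submatrix B at
    y = adj(B) a, with a alternating.  If y has both signs, extend y by zeros to
    a vector x: then B y is a subsequence of A x, and passing to a subsequence
    does not increase S and preserves the extreme signs when S is preserved
    ([variation_diminished_extension]).  If y has constant weak sign, then so
    does B y, as B has constant weak sign; but B y = det(B) a alternates, so
    B y = 0 ([variation_diminished_adj]).

    Why the property at y = adj(B) a bounds the minor det(B), of order r.  If
    the smaller minors are non-positive, then the entries of the first row of
    adj(B) have alternating signs, so the first coordinate of y is zero or has
    sign opposite to that of a.  If det(B) were positive, then
    B y = det(B) a would have r - 1 sign changes, forcing S(y) = r - 1, and
    the first coordinate of y would have the same sign as a: a contradiction
    ([det_le0_of_variation_adj]). *)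

Set Implicit Arguments.
Unset Strict Implicit.
Unset Printing Implicit Defensive.

Import Order.TTheory GRing.Theory Num.Theory.

Local Open Scope ring_scope.

(** * Sign changes in sequences *)

Section Sequences.
Variable R : rcfType.
Implicit Types (a b c : R) (s t : seq R).

Lemma sgr_eq_opp a b : a * b < 0 -> Num.sg b = - Num.sg a.
Proof.
case: (sgrP a) => [->|a_gt0|a_lt0]; first by rewrite mul0r ltxx.
  by rewrite pmulr_rlt0 // => /ltr0_sg.
by rewrite nmulr_rlt0 // opprK => /gtr0_sg.
Qed.

Lemma sgr_eq_of_mul_ge0 a b :
  a != 0 -> b != 0 -> (a * b < 0) = false -> Num.sg b = Num.sg a.
Proof.
move=> a_neq0 b_neq0 /negbT; rewrite -leNgt => ab_ge0.
have : 0 < a * b by rewrite lt0r mulf_neq0.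
case: (sgrP a) => [->|a_gt0|a_lt0]; first by rewrite mul0r ltxx.
  by rewrite pmulr_rgt0 // => /gtr0_sg.
by rewrite nmulr_rgt0 // => /ltr0_sg.
Qed.

Lemma head_filter_neq0 s :
  [seq c <- s | c != 0] != [::] -> head 0 [seq c <- s | c != 0] != 0.
Proof.
move=> t_neq0; have := filter_all (fun c : R => c != 0) s.
by case: (filter _ _) t_neq0 => //= b t _ /andP[].
Qed.

(** The witness [b i] counts the sign changes that occur up to position [i]; a
    zero entry joins the block of the next nonzero entry, or the last block. *)
Lemma sign_blocks s : let t := [seq c <- s | c != 0] in
  exists b : nat -> nat,
    [/\ {homo b : i j / (i <= j)%N}, forall i, (b i <= changes t)%N
      & forall i, s`_i = `|s`_i| * (Num.sg (head 0 t) * (-1) ^+ b i)].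
Proof.
elim: s => [|a s [b [b_homo b_le b_sg]]] /=.
  by exists (fun=> 0%N); split=> // i; rewrite nth_nil normr0 mul0r.
have [->|a_neq0] /= := eqVneq a 0.
  exists (fun i => b i.-1); split=> [i j leij|//|[|i]] /=.
  - by apply: b_homo; lia.
  - by rewrite normr0 mul0r.
  - exact: b_sg.
set t := [seq c <- s | c != 0] in b_le b_sg *.
have [t0|t_neq0] := eqVneq t [::].
  exists (fun=> 0%N); split=> // -[|i] /=; rewrite expr0 mulr1.
    by rewrite mulrC -numEsg.
  by have := b_sg i; rewrite t0 /= sgr0 mul0r mulr0 => ->; rewrite normr0 mul0r.
have h_neq0 := head_filter_neq0 t_neq0.
case: (boolP (a * head 0 t < 0)) =>
  [/sgr_eq_opp sg_h | /negbTE /sgr_eq_of_mul_ge0 sg_h].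
  exists (fun i => if i is i'.+1 then (b i').+1 else 0%N).
  split=> [[|i] [|j]|[|i]|[|i]] //=; rewrite ?add1n ?ltnS //.
  - exact: b_homo.
  - by rewrite expr0 mulr1 mulrC -numEsg.
  - by rewrite exprS mulN1r mulrN -mulNr -sg_h.
exists (fun i => if i is i'.+1 then b i' else 0%N).
split=> [[|i] [|j]|[|i]|[|i]] //=; rewrite ?add0n ?ltnS //.
- exact: b_homo.
- by rewrite expr0 mulr1 mulrC -numEsg.
- by rewrite -sg_h.
Qed.

(** The selected positions are those of the last nonzero entry of each block of
    constant weak sign. *)
Lemma alternating_selection s : let t := [seq c <- s | c != 0] in
  t != [::] ->
  exists f : nat -> nat,
    [/\ {homo f : i j / (i < j)%N},
        forall i, (i <= changes t)%N -> (f i < size s)%N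
      & forall i, (i <= changes t)%N ->
          Num.sg s`_(f i) = Num.sg (head 0 t) * (-1) ^+ i].
Proof.
elim: s => [//|a s IHs] /=.
have [->|a_neq0] /= := eqVneq a 0.
  by case/IHs=> f [f_homo f_lt f_sg]; exists (S \o f).
move=> _; set t := [seq c <- s | c != 0] in IHs *.
have [t0|t_neq0] := eqVneq t [::].
  rewrite t0 /= mulr0 ltxx.
  by exists id; split=> // i; rewrite leqn0 => /eqP -> //; rewrite mulr1.
have [f [f_homo f_lt f_sg]] := IHs t_neq0.
have h_neq0 := head_filter_neq0 t_neq0.
case: (boolP (a * head 0 t < 0)) =>
  [/sgr_eq_opp sg_h | /negbTE /sgr_eq_of_mul_ge0 sg_h].
  exists (fun i => if i is i'.+1 then (f i').+1 else 0%N).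
  split=> [[|i] [|j]|[|i]|[|i]] //=; rewrite ?add1n ?ltnS.
  - exact: f_homo.
  - exact: f_lt.
  - by rewrite mulr1.
  - by move/f_sg->; rewrite exprS mulN1r mulrN -mulNr -sg_h.
by exists (S \o f); split=> //= i ?; rewrite -sg_h ?f_sg.
Qed.

Lemma changes_size s : (changes s <= (size s).-1)%N.
Proof.
elim: s => //= a [|b s] /=; first by rewrite mulr0 ltxx.
by case: (_ < 0) => /=; lia.
Qed.

Lemma changes_alternating s :
  (forall i, (i.+1 < size s)%N -> s`_i * s`_i.+1 < 0) ->
  changes s = (size s).-1.
Proof.
elim: s => //= a [|b s] IHs alt; first by rewrite /= mulr0 ltxx.
rewrite IHs; last by move=> i; apply: (alt i.+1).
by have := alt 0; rewrite /= => ->.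
Qed.

Lemma sgr_last_changes s : all (fun c => c != 0) s ->
  Num.sg (last 0 s) = Num.sg (head 0 s) * (-1) ^+ changes s.
Proof.
elim: s => [|a [|b s] IHs] /=; first by rewrite sgr0 mul0r.
  by rewrite mulr0 ltxx mulr1.
case/and3P=> a_neq0 b_neq0 s_neq0; rewrite IHs /= ?b_neq0 //.
case: (boolP (a * b < 0)) => [/sgr_eq_opp -> | /negbTE /sgr_eq_of_mul_ge0 -> //].
by rewrite exprS mulN1r mulrN mulNr.
Qed.

(** If both [a], [b] and [b], [c] agree in sign, then so do [a], [c], because
    [b] is nonzero. *)
Lemma sign_change_triangle a b c : b != 0 ->
  ((a * c < 0)%R <= (a * b < 0)%R + (b * c < 0)%R)%N.
Proof.
move=> b_neq0; case: (boolP (a * c < 0)) => // ac.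
case: (boolP (a * b < 0)) => //; rewrite -leNgt => ab.
suff -> : b * c < 0 by [].
rewrite ltNge; apply/negP => bc.
have b2_gt0 : 0 < b ^+ 2 by rewrite exprn_even_gt0.
have := mulr_ge0 ab bc; have := nmulr_rlt0 (b ^+ 2) ac; rewrite b2_gt0.
by rewrite (_ : a * c * b ^+ 2 = a * b * (b * c)) ?leNgt => [->|]; last ring.
Qed.

(** The extra term makes the induction go through, and it is what shows that a
    subsequence with as many sign changes starts with the same sign: the entries
    dropped in front of an opposite sign cost one more sign change. *)
Lemma changes_subseq s t :
  all (fun c => c != 0) t -> subseq s t -> s != [::] ->
  (changes s + (head 0 s * head 0 t < 0)%R <= changes t)%N.
Proof.
elim: t s => [|b t IHt] [|a s] //= /andP[b_neq0 t_neq0].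
case: eqVneq => [-> | _] sub _.
  have -> : (b * b < 0) = false by apply/negbTE; rewrite -leNgt sqr_ge0.
  case: s sub => [|c s] sub; first by rewrite /= mulr0 ltxx.
  have := IHt _ t_neq0 sub isT.
  have := sign_change_triangle b c (b := head 0 t).
  case: t t_neq0 sub {IHt} => //= d t /andP[d_neq0 _] _ /(_ d_neq0).
  by rewrite (mulrC c d) /=; do !case: (_ < 0); lia.
have := IHt _ t_neq0 sub isT.
have := sign_change_triangle a b (b := head 0 t).
case: t t_neq0 sub {IHt} => //= d t /andP[d_neq0 _] _ /(_ d_neq0).
by rewrite (mulrC d b) /=; do !case: (_ < 0); lia.
Qed.

End Sequences.

(** * Increasing maps of indices *)

Section Increasing.

Lemma increasing_lift n (i : 'I_n.+1) : @increasing n n.+1 (lift i).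
Proof. by move=> j k ltjk; rewrite /= /bump; do 2 case: leqP; lia. Qed.

Lemma increasing_comp n p q (f : 'I_p -> 'I_q) (g : 'I_n -> 'I_p) :
  increasing f -> increasing g -> increasing (f \o g).
Proof. by move=> f_incr g_incr i j /g_incr /f_incr. Qed.

Lemma increasing_inj n p (f : 'I_n -> 'I_p) : increasing f -> injective f.
Proof.
move=> f_incr i j eq_f; apply/val_inj => /=.
by case: (ltngtP i j) => // /f_incr; rewrite eq_f ltnn.
Qed.

Lemma increasing_leq n p (f : 'I_n -> 'I_p) : increasing f -> (n <= p)%N.
Proof.
by move=> /increasing_inj /leq_card; rewrite !card_ord.
Qed.

(** Turns a selection of coordinates by an increasing map into a filter, the
    form in which it is compared with the other filter, that of nonzero
    coordinates. *)
Lemma map_increasing_enum n p (f : 'I_n -> 'I_p) : increasing f ->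
  [seq f i | i <- enum 'I_n] = [seq j <- enum 'I_p | j \in codom f].
Proof.
move=> f_incr; have enum_sorted q : sorted (relpre val ltn) (enum 'I_q).
  by rewrite -sorted_map val_enum_ord iota_ltn_sorted.
apply: (irr_sorted_eq (leT := relpre val ltn)).
- by move=> j i k /=; apply: ltn_trans.
- by move=> i /=; rewrite ltnn.
- by apply: homo_sorted (enum_sorted n) => i j; apply: f_incr.
- by apply: sorted_filter (enum_sorted p) => j i k /=; apply: ltn_trans.
- by move=> j; rewrite mem_filter mem_enum andbT -codomE.
Qed.

End Increasing.

(** * Sign changes of vectors *)

Section Vectors.
Variable R : rcfType.

Lemma coord_nth n (x : 'cV[R]_n) (i : 'I_n) :
  [seq x j 0 | j <- enum 'I_n]`_i = x i 0.
Proof. by rewrite (nth_map i) ?size_enum_ord // nth_ord_enum. Qed.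

Lemma nonzero_coords_all n (x : 'cV[R]_n) :
  all (fun c => c != 0) (nonzero_coords x).
Proof. exact: filter_all. Qed.

Lemma nonzero_coords_eq0 n (x : 'cV[R]_n) : (nonzero_coords x == [::]) = (x == 0).
Proof.
rewrite /nonzero_coords -[_ == [::]]negbK -has_filter has_map -all_predC.
apply/allP/eqP => [x0|-> i _]; last by rewrite /= mxE eqxx.
by apply/colP => i; have /= := x0 i (mem_enum _ i); rewrite negbK mxE => /eqP.
Qed.

Lemma sign_changes0 n : sign_changes (0 : 'cV[R]_n) = 0%N.
Proof.
rewrite /sign_changes; have := nonzero_coords_eq0 (0 : 'cV[R]_n).
by rewrite eqxx => /eqP ->.
Qed.

Lemma variation_diminished_ker m n (A : 'M[R]_(m, n)) (x : 'cV[R]_n) :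
  A *m x = 0 -> variation_diminished A x.
Proof.
by move=> Ax0; rewrite /variation_diminished Ax0 sign_changes0 eqxx; split.
Qed.

Lemma first_nonzero_neq0 n (x : 'cV[R]_n) : x != 0 -> first_nonzero x != 0.
Proof. by rewrite -nonzero_coords_eq0; apply: head_filter_neq0. Qed.

Lemma sg_last_nonzero n (x : 'cV[R]_n) :
  Num.sg (last_nonzero x) = Num.sg (first_nonzero x) * (-1) ^+ sign_changes x.
Proof. exact/sgr_last_changes/nonzero_coords_all. Qed.

Lemma sign_blocks_cV n (x : 'cV[R]_n) :
  exists2 b : 'I_n -> 'I_(sign_changes x).+1,
    {homo b : i j / (i <= j)%N} &
    forall i, x i 0 = `|x i 0| * (Num.sg (first_nonzero x) * (-1) ^+ b i).
Proof.
have [b [b_homo b_le b_sg]] := sign_blocks [seq x i 0 | i <- enum 'I_n].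
exists (fun i => Ordinal (b_le i : b i < (sign_changes x).+1)%N) => [i j|i].
  exact: b_homo.
by have := b_sg i; rewrite coord_nth.
Qed.

Lemma alternating_selection_cV n q (x : 'cV[R]_n) :
  x != 0 -> (q <= sign_changes x)%N ->
  exists2 f : 'I_q.+1 -> 'I_n, increasing f &
    forall i, Num.sg (x (f i) 0) = Num.sg (first_nonzero x) * (-1) ^+ i.
Proof.
rewrite -nonzero_coords_eq0 => x_neq0 le_q.
have [f [f_homo f_lt f_sg]] := alternating_selection x_neq0.
rewrite size_map size_enum_ord in f_lt.
have le_i (i : 'I_q.+1) : (i <= sign_changes x)%N by have := ltn_ord i; lia.
exists (fun i : 'I_q.+1 => Ordinal (f_lt i (le_i i))) => [i j|i]; first exact: f_homo.
by rewrite -f_sg // -coord_nth.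
Qed.

Lemma nonzero_coords_rowsub n p (f : 'I_n -> 'I_p) (x : 'cV[R]_p) :
  increasing f -> subseq (nonzero_coords (rowsub f x)) (nonzero_coords x).
Proof.
move=> f_incr; rewrite subseq_filter nonzero_coords_all.
apply: subseq_trans (filter_subseq _ _) _.
rewrite (eq_map (g := (fun i => x i 0) \o f)) => [|i]; last by rewrite mxE.
by rewrite map_comp map_increasing_enum // map_subseq ?filter_subseq.
Qed.

Lemma extension_coord n p (g : 'I_n -> 'I_p) (y : 'cV[R]_n) i :
  increasing g -> (colsub g 1%:M *m y) (g i) 0 = y i 0.
Proof.
move=> g_incr; rewrite mxE (bigD1 i) //= !mxE eqxx mul1r big1 ?addr0 // => j jNi.
by rewrite !mxE (inj_eq (increasing_inj g_incr)) eq_sym (negPf jNi) mul0r.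
Qed.

(** [colsub g 1%:M *m y] is the extension of [y] by zeros along [g]. *)
Lemma nonzero_coords_extension n p (g : 'I_n -> 'I_p) (y : 'cV[R]_n) :
  increasing g -> nonzero_coords (colsub g 1%:M *m y) = nonzero_coords y.
Proof.
move=> g_incr; set x := _ *m y.
have x_out j : j \notin codom g -> x j 0 = 0.
  move=> jNg; rewrite mxE big1 // => i _; rewrite !mxE.
  by case: eqP jNg => [->|_ _]; rewrite ?codom_f ?mul0r.
have x_in i : x (g i) 0 = y i 0 by apply: extension_coord.
rewrite {2}/nonzero_coords -(eq_map x_in) (map_comp (fun j => x j 0)).
rewrite map_increasing_enum // /nonzero_coords; move: (enum 'I_p) => js.
rewrite !filter_map -filter_predI; congr (map _ _); apply: eq_filter => j /=.
by case: (boolP (j \in codom g)) => [|/x_out ->]; rewrite ?andbT ?eqxx.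
Qed.

Section Alternating.
Variable k : nat.
Implicit Type y : 'cV[R]_k.+1.

Lemma alternating_sg y i :
  alternating y -> Num.sg (y i 0) = Num.sg (y ord0 0) * (-1) ^+ i.
Proof.
case=> _ y_alt; case: i => i; elim: i => [|i IHi] lt_i.
  by rewrite mulr1; congr (Num.sg (y _ 0)); apply: val_inj.
rewrite (sgr_eq_opp (y_alt (Ordinal (ltnW lt_i)) _ _)) //.
by rewrite IHi /= exprS mulN1r mulrN.
Qed.

Lemma alternating_of_sg y (e : R) : e != 0 ->
  (forall i, Num.sg (y i 0) = Num.sg e * (-1) ^+ i) -> alternating y.
Proof.
move=> e_neq0 y_sg; split=> [i|i j ji].
  by rewrite -sgr_eq0 y_sg mulf_neq0 ?signr_eq0 ?sgr_eq0.
rewrite -sgr_cp0 sgrM !y_sg ji exprS mulrACA mulN1r mulrN -expr2 -signr_odd.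
by rewrite sqr_sg e_neq0 mul1r -expr2 sqrr_sign.
Qed.

Lemma nonzero_coords_alternating y :
  alternating y -> nonzero_coords y = [seq y i 0 | i <- enum 'I_k.+1].
Proof.
move=> [y_neq0 _]; apply/all_filterP/allP => _ /mapP[i _ ->]; exact: y_neq0.
Qed.

Lemma sign_changes_alternating y : alternating y -> sign_changes y = k.
Proof.
move=> y_alt; rewrite /sign_changes nonzero_coords_alternating //.
rewrite changes_alternating size_map size_enum_ord // => i lt_i.
rewrite -[i]/(val (Ordinal (ltnW lt_i))) -[(val _).+1]/(val (Ordinal lt_i)).
by rewrite !coord_nth; apply: y_alt.2.
Qed.

(** The maximal number of sign changes leaves no room for a zero coordinate. *)
Lemma first_nonzero_full y :
  (0 < k)%N -> sign_changes y = k -> first_nonzero y = y ord0 0.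
Proof.
move=> k_gt0; rewrite /sign_changes /first_nonzero /nonzero_coords.
set s := [seq y i 0 | i <- enum 'I_k.+1] => y_k.
have s_size : size s = k.+1 by rewrite size_map size_enum_ord.
have := changes_size [seq c <- s | c != 0].
rewrite y_k size_filter => le_k.
have /all_filterP -> : all (fun c => c != 0) s.
  rewrite all_count eqn_leq count_size s_size /=.
  by move: le_k k_gt0; case: (count _ s) => [|c]; case: (k).
by rewrite -nth0; apply: (coord_nth y ord0).
Qed.

Lemma first_nonzero_alternating y : alternating y -> first_nonzero y = y ord0 0.
Proof.
move=> y_alt; rewrite /first_nonzero nonzero_coords_alternating //.
by rewrite -nth0; apply: (coord_nth y ord0).
Qed.

End Alternating.
End Vectors.

(** * Minors of totally non-positive matrices *)

Section CauchyBinet.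
Variable R : rcfType.

(** The multilinear form of the Cauchy-Binet expansion, before the terms with
    the same set of columns are collected. *)
Lemma det_mulmx_colsub r n (A : 'M[R]_(r, n)) (W : 'M[R]_(n, r)) :
  \det (A *m W) =
  \sum_(h : {ffun 'I_r -> 'I_n}) (\prod_k W (h k) k) * \det (colsub h A).
Proof.
have det_by_col p (B : 'M[R]_p) :
    \det B = \sum_(s : 'S_p) (-1) ^+ s * \prod_i B (s i) i.
  rewrite -det_tr; apply: eq_bigr => s _; congr (_ * _).
  by apply: eq_bigr => i; rewrite mxE.
rewrite det_by_col.
transitivity (\sum_(s : 'S_r) \sum_(h : {ffun 'I_r -> 'I_n})
    (\prod_k W (h k) k) * ((-1) ^+ s * \prod_i A (s i) (h i))).
  apply: eq_bigr => s _; under eq_bigr do rewrite mxE.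
  rewrite bigA_distr_bigA /= mulr_sumr; apply: eq_bigr => h _.
  by rewrite big_split /= [LHS]mulrA [LHS]mulrC.
rewrite exchange_big; apply: eq_bigr => h _ /=; rewrite det_by_col mulr_sumr.
apply: eq_bigr => s _; congr (_ * (_ * _)).
by apply: eq_bigr => i _; rewrite mxE.
Qed.

End CauchyBinet.

Section Minors.
Variable R : rcfType.

Lemma tnp_det_le0 m n r (A : 'M[R]_(m, n)) (f : 'I_r -> 'I_m) (g : 'I_r -> 'I_n) :
  totally_nonpositive A -> (0 < r)%N -> increasing f -> increasing g ->
  \det (mxsub f g A) <= 0.
Proof.
move=> A_tnp r_gt0 f_incr g_incr; apply: A_tnp => //.
by rewrite r_gt0 leq_min (increasing_leq f_incr) (increasing_leq g_incr).
Qed.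

Lemma tnp_mxsub m n p q (A : 'M[R]_(m, n)) (f : 'I_p -> 'I_m) (g : 'I_q -> 'I_n) :
  totally_nonpositive A -> increasing f -> increasing g ->
  totally_nonpositive (mxsub f g A).
Proof.
move=> A_tnp f_incr g_incr r f' g' /andP[r_gt0 _] f'_incr g'_incr.
by rewrite -mxsub_comp; apply: tnp_det_le0 => //; apply: increasing_comp.
Qed.

(** In the expansion of a minor of [A *m W], a choice [h] of columns of [A]
    contributes only if [b \o h] is the increasing map [g]; as [b] is monotone,
    [h] is then increasing, so that its term involves a genuine minor of [A]. *)
Lemma tnp_mul_blocks m n p (A : 'M[R]_(m, n)) (W : 'M[R]_(n, p))
    (b : 'I_n -> 'I_p) :
  totally_nonpositive A -> {homo b : i j / (i <= j)%N} ->
  (forall i j, 0 <= W i j) -> (forall i j, b i != j -> W i j = 0) ->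
  totally_nonpositive (A *m W).
Proof.
move=> A_tnp b_homo W_ge0 W_block r f g /andP[r_gt0 _] f_incr g_incr.
rewrite mxsub_mul det_mulmx_colsub; apply: sumr_le0 => h _.
have [/forallP bh | /forallPn[k bhk]] := boolP [forall k, b (h k) == g k]; last first.
  by rewrite (bigD1 k) //= mxE W_block // !mul0r.
apply: mulr_ge0_le0; first by apply: prodr_ge0 => k _; rewrite mxE.
rewrite -mxsub_comp; apply: tnp_det_le0 => // i j /g_incr.
rewrite -(eqP (bh i)) -(eqP (bh j)) !ltnNge; apply: contra; exact: b_homo.
Qed.

(** Cramer's rule for the first coordinate. *)
Lemma sum_cofactor_mul k (N : 'M[R]_k.+1) (z : 'cV[R]_k.+1) :
  \sum_i cofactor N i ord0 * (N *m z) i 0 = \det N * z ord0 0.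
Proof.
transitivity ((\adj N *m (N *m z)) ord0 0).
  by rewrite mxE; apply: eq_bigr => i _; rewrite [in RHS]mxE.
by rewrite mulmxA mul_adj_mx mul_scalar_mx mxE.
Qed.

(** The sign of the cofactor cancels the alternation of [y]. *)
Lemma cofactor_alternating_le0 k (N : 'M[R]_k.+1) (y : 'cV[R]_k.+1) i :
  alternating y -> \det (row' i (col' ord0 N)) <= 0 ->
  cofactor N i ord0 * y i 0 * y ord0 0 <= 0.
Proof.
move=> y_alt minor_le0; rewrite /cofactor addn0.
have -> : (-1) ^+ i * \det (row' i (col' ord0 N)) * y i 0 * y ord0 0
        = \det (row' i (col' ord0 N)) * (`|y i 0| * `|y ord0 0|).
  rewrite [in LHS](numEsg (y i 0)) alternating_sg // [`|y ord0 0|]normrEsg.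
  rewrite -[RHS]mul1r -[in RHS](sqrr_sign R i); ring.
by rewrite mulr_le0_ge0 ?mulr_ge0.
Qed.

(** Subtracting a multiple of a kernel vector of [B] cancels a coordinate of [c]
    without changing the image. *)
Lemma singular_drop_column k (B : 'M[R]_k.+1) (c : 'cV[R]_k.+1) :
  \det B = 0 -> exists j (c' : 'cV[R]_k), B *m c = col' j B *m c'.
Proof.
rewrite -det_tr => /eqP/det0P[v v_neq0 vB0].
have {}vB0 : B *m v^T = 0 by rewrite -[B]trmxK -trmx_mul vB0 trmx0.
have /rV0Pn[j vj_neq0] := v_neq0.
pose d := c - (c j 0 / v 0 j) *: v^T.
have dj0 : d j 0 = 0 by rewrite !mxE mulfVK ?subrr.
exists j, (row' j d).
have -> : B *m c = B *m d by rewrite mulmxBr -scalemxAr vB0 scaler0 subr0.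
apply/colP => i; rewrite !mxE (bigD1_ord j) //= dj0 mulr0 add0r.
by apply: eq_bigr => l _; rewrite !mxE.
Qed.

Lemma alternating_rowsub_widen n p (le_np : (n <= p)%N) (y : 'cV[R]_p) :
  alternating y -> alternating (rowsub (widen_ord le_np) y).
Proof.
by move=> [y_neq0 y_alt]; split=> [i|i j ij]; rewrite !mxE //; apply: y_alt.
Qed.

(** A totally non-positive matrix with [k] columns has no image with [k] sign
    changes, whatever its rank. *)
Lemma tnp_alternating_image k (M : 'M[R]_(k.+1, k)) (c : 'cV[R]_k) :
  totally_nonpositive M -> ~ alternating (M *m c).
Proof.
elim: k => [|k IHk] in M c * => M_tnp Mc_alt.
  by have := Mc_alt.1 ord0; rewrite mxE big_ord0 eqxx.
(* Otherwise the top block, with one column dropped, contradicts IHk. *)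
have top_neq0 : \det (rowsub (widen_ord (leqnSn k.+1)) M) != 0.
  apply/eqP => /(singular_drop_column c) [j [c' top_eq]].
  apply: (IHk (col' j (rowsub (widen_ord (leqnSn k.+1)) M)) c').
    rewrite col'Esub; apply: tnp_mxsub => //; last exact: increasing_lift.
    exact: tnp_mxsub.
  by rewrite -top_eq mul_rowsub_mx; apply: alternating_rowsub_widen.
(* Bordering [M] by a zero column turns its maximal minors into the cofactors
   of a singular square matrix. *)
pose N : 'M[R]_k.+2 :=
  \matrix_(i, j) if unlift ord0 j is Some j' then M i j' else 0.
pose z : 'cV[R]_k.+2 := \col_j if unlift ord0 j is Some j' then c j' 0 else 0.
have N_col : col' ord0 N = M by apply/matrixP => i j; rewrite !mxE liftK.
have N_mul : N *m z = M *m c.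
  apply/colP => i; rewrite !mxE big_ord_recl !mxE unlift_none mul0r add0r.
  by apply: eq_bigr => j _; rewrite !mxE liftK.
have minor_le0 i : \det (row' i (col' ord0 N)) <= 0.
  rewrite N_col row'Esub; apply: tnp_det_le0 => //; exact: increasing_lift.
have /psumr_eq0P sum_eq0 : forall i : 'I_k.+2, true ->
    0 <= - (cofactor N i ord0 * (M *m c) i 0 * (M *m c) ord0 0).
  by move=> i _; rewrite oppr_ge0; apply: cofactor_alternating_le0.
have sum0 : \sum_i - (cofactor N i ord0 * (M *m c) i 0 * (M *m c) ord0 0) = 0.
  rewrite sumrN -mulr_suml -N_mul sum_cofactor_mul !mxE unlift_none mulr0.
  by rewrite mul0r oppr0.
have /eqP := sum_eq0 sum0 ord_max isT.
rewrite oppr_eq0 !mulf_eq0 !(negPf (Mc_alt.1 _)) !orbF signr_eq0 N_col /=.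
have -> : row' ord_max M = rowsub (widen_ord (leqnSn k.+1)) M.
  by apply: eq_rowsub => i; apply: val_inj; apply: lift_max.
by rewrite (negPf top_neq0).
Qed.

Lemma tnp_alternating_square k (B : 'M[R]_k.+1) (c : 'cV[R]_k.+1) :
  totally_nonpositive B -> alternating (B *m c) -> \det B < 0.
Proof.
move=> B_tnp Bc_alt; rewrite lt_def; apply/andP; split.
  rewrite eq_sym; apply/eqP => /(singular_drop_column c) [j [c' Bc_eq]].
  rewrite Bc_eq in Bc_alt; apply: tnp_alternating_image Bc_alt.
  by rewrite col'Esub; apply: tnp_mxsub => //; apply: increasing_lift.
by rewrite -[B]mxsub_id; apply: tnp_det_le0.
Qed.

Lemma tnp_alternating_square_sg k (B : 'M[R]_k.+1) (c : 'cV[R]_k.+1) :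
  (0 < k)%N -> totally_nonpositive B -> alternating (B *m c) ->
  0 <= c ord0 0 * (B *m c) ord0 0.
Proof.
move=> k_gt0 B_tnp Bc_alt; have detB_lt0 := tnp_alternating_square B_tnp Bc_alt.
rewrite -(nmulr_rle0 _ detB_lt0) mulrA -sum_cofactor_mul mulr_suml.
apply: sumr_le0 => i _; apply: cofactor_alternating_le0 => //.
rewrite row'Esub col'Esub -mxsub_comp.
by apply: tnp_det_le0 => //; apply: increasing_lift.
Qed.

Lemma tnp_variation_diminished m n (A : 'M[R]_(m, n)) (x : 'cV[R]_n) :
  totally_nonpositive A -> has_both_signs x -> variation_diminished A x.
Proof.
move=> A_tnp [[i xi_gt0] [j xj_lt0]].
have [y0|y_neq0] := eqVneq (A *m x) 0.
  exact: variation_diminished_ker.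
have x_neq0 : x != 0.
  by apply: contraTneq xi_gt0 => ->; rewrite mxE ltxx.
have e_neq0 := first_nonzero_neq0 x_neq0.
have y1_neq0 := first_nonzero_neq0 y_neq0.
have [b b_homo x_eq] := sign_blocks_cV x.
set p := sign_changes x in b b_homo x_eq *.
pose W : 'M[R]_(n, p.+1) := \matrix_(j, t) if b j == t then `|x j 0| else 0.
pose c : 'cV[R]_p.+1 := \col_t (Num.sg (first_nonzero x) * (-1) ^+ t).
have Wc : W *m c = x.
  apply/colP => l; rewrite mxE (bigD1 (b l)) //= !mxE eqxx big1 ?addr0 -?x_eq //.
  by move=> t; rewrite eq_sym => /negPf bl; rewrite mxE bl mul0r.
have AW_tnp : totally_nonpositive (A *m W).
  apply: tnp_mul_blocks A_tnp b_homo _ _ => l t; rewrite mxE; first by case: ifP.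
  by move/negPf->.
have AWc : A *m W *m c = A *m x by rewrite -mulmxA Wc.
(* For p = 0 the minors of size p in Cramer's rule would be the empty minor 1;
   this is where both signs of x are needed. *)
have p_gt0 : (0 < p)%N.
  rewrite lt0n; apply/eqP => p0.
  have x_sg l : x l 0 = `|x l 0| * Num.sg (first_nonzero x).
    rewrite {1}x_eq (_ : b l = 0%N :> nat) ?mulr1 //.
    by have := ltn_ord (b l); rewrite {2}p0; case: (b l : nat).
  have : 0 < x i 0 * - x j 0 by rewrite mulr_gt0 ?oppr_gt0.
  rewrite (x_sg i) (x_sg j) mulrN mulrACA -expr2 oppr_gt0 ltNge.
  by rewrite (mulr_ge0 (mulr_ge0 (normr_ge0 _) (normr_ge0 _)) (sqr_ge0 _)).
have alt_rows q : (q <= sign_changes (A *m x))%N ->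
    exists2 f : 'I_q.+1 -> 'I_m, increasing f &
      alternating (rowsub f (A *m W) *m c) /\
      Num.sg ((rowsub f (A *m W) *m c) ord0 0) = Num.sg (first_nonzero (A *m x)).
  case/(alternating_selection_cV y_neq0) => f f_incr f_sg; exists f => //.
  rewrite mul_rowsub_mx AWc; split; last by rewrite mxE f_sg mulr1.
  by apply: alternating_of_sg y1_neq0 _ => l; rewrite mxE.
have f_tnp q (f : 'I_q -> 'I_m) : increasing f ->
    totally_nonpositive (rowsub f (A *m W)).
  by move=> f_incr; apply: tnp_mxsub.
split.
  rewrite leqNgt; apply/negP => /alt_rows[f /f_tnp f_incr [y_alt _]].
  exact: tnp_alternating_image y_alt.
move=> eq_p _; rewrite !sg_last_nonzero eq_p.
suff -> : Num.sg (first_nonzero (A *m x)) = Num.sg (first_nonzero x) by [].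
have [|f f_incr [y_alt <-]] := alt_rows p; first by rewrite eq_p.
have := tnp_alternating_square_sg p_gt0 (f_tnp _ _ f_incr) y_alt.
rewrite {1}/c mxE mulr1 => y_ge0.
rewrite -[RHS]sgr_id; apply: sgr_eq_of_mul_ge0.
- by rewrite sgr_eq0.
- exact: y_alt.1.
- by apply/negbTE; rewrite -leNgt.
Qed.

End Minors.

(** * The adjugate criterion *)

Section Criterion.
Variable R : rcfType.

Lemma variation_diminished_extension m n p q (A : 'M[R]_(m, n))
    (f : 'I_p -> 'I_m) (g : 'I_q -> 'I_n) (y : 'cV[R]_q) :
  increasing f -> increasing g ->
  variation_diminished A (colsub g 1%:M *m y) ->
  variation_diminished (mxsub f g A) y.
Proof.
move=> f_incr g_incr; set x := _ *m y => -[le_x eq_x].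
have Ay : mxsub f g A *m y = rowsub f (A *m x).
  by rewrite /x -mul_rowsub_mx mulmxA -mxsub_mul mulmx1.
have x_coords : nonzero_coords x = nonzero_coords y by apply: nonzero_coords_extension.
have sub := nonzero_coords_rowsub (A *m x) f_incr.
have [z0|z_neq0] := eqVneq (rowsub f (A *m x)) 0.
  by apply: variation_diminished_ker; rewrite Ay.
rewrite /variation_diminished Ay.
have := changes_subseq (nonzero_coords_all _) sub _.
rewrite nonzero_coords_eq0 => /(_ z_neq0) le_z.
have x_changes : sign_changes x = sign_changes y by rewrite /sign_changes x_coords.
have le_Ax := leq_trans (leq_addr _ _) le_z.
split=> [|eq_z _]; first by rewrite -x_changes; apply: leq_trans le_x.
have eq_Ax : sign_changes (A *m x) = sign_changes x.
  by apply/eqP; rewrite eqn_leq le_x x_changes -eq_z.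
have Ax_neq0 : A *m x != 0.
  by apply: contraNneq z_neq0 => ->; rewrite mxsub_const.
have [first_eq _] := eq_x eq_Ax Ax_neq0.
rewrite !sg_last_nonzero eq_z.
suff -> : Num.sg (first_nonzero (rowsub f (A *m x))) = Num.sg (first_nonzero y) by [].
have -> : first_nonzero y = first_nonzero x by rewrite /first_nonzero x_coords.
rewrite -first_eq; apply/esym/sgr_eq_of_mul_ge0.
- exact: first_nonzero_neq0.
- exact: first_nonzero_neq0.
apply: contraTF le_z => head_lt0; rewrite head_lt0 addn1 -ltnNge ltnS.
by rewrite -[changes (nonzero_coords (A *m x))]/(sign_changes _) eq_Ax x_changes -eq_z.
Qed.

Lemma alternating_signs r : alternating (\col_(i < r) (-1) ^+ i : 'cV[R]_r).
Proof.
split=> [i|i j ij]; rewrite !mxE ?signr_eq0 // ij exprS mulN1r mulrN -expr2.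
by rewrite sqrr_sign oppr_lt0 ltr01.
Qed.

(** Both signs occur in [\adj B *m a] unless its image, which is
    [\det B *: a], vanishes: a non-positive [B] cannot map a vector of constant
    weak sign to an alternating one. *)
Lemma variation_diminished_adj r (B : 'M[R]_r.+2) (a : 'cV[R]_r.+2) :
  alternating a ->
  (has_both_signs (\adj B *m a) -> variation_diminished B (\adj B *m a)) ->
  (forall i j, B i j <= 0) ->
  variation_diminished B (\adj B *m a).
Proof.
move=> a_alt var B_le0; set y := _ *m a in var *.
have By : B *m y = \det B *: a by rewrite mulmxA mul_mx_adj mul_scalar_mx.
have [By0|By_neq0] := eqVneq (B *m y) 0.
  exact: variation_diminished_ker.
have det_neq0 : \det B != 0.
  by apply: contraNneq By_neq0 => det0; rewrite By det0 scale0r.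
have By_lt0 : (B *m y) ord0 0 * (B *m y) (lift ord0 ord0) 0 < 0.
  rewrite By !mxE mulrACA -expr2 pmulr_rlt0 ?exprn_even_gt0 //.
  exact: a_alt.2.
apply: var; split; apply/existsP; apply: contraTT By_lt0 => /existsPn y_sg;
  rewrite -leNgt !mxE.
  rewrite mulr_ge0 // sumr_ge0 // => i _; rewrite mulr_le0 //.
    by rewrite leNgt.
  by rewrite leNgt.
by rewrite mulr_le0 // sumr_le0 // => i _; rewrite mulr_le0_ge0 // leNgt.
Qed.

(** The signs of the cofactors keep [\adj B *m a] from starting with the sign of
    [a], whereas a positive determinant would force it to do so. *)
Lemma det_le0_of_variation_adj r (B : 'M[R]_r.+2) (a : 'cV[R]_r.+2) :
  (forall i, \det (row' i (col' ord0 B)) <= 0) ->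
  alternating a -> variation_diminished B (\adj B *m a) ->
  \det B <= 0.
Proof.
move=> minor_le0 a_alt; set y := _ *m a => -[le_y eq_y].
rewrite leNgt; apply/negP => det_gt0.
have By : B *m y = \det B *: a by rewrite mulmxA mul_mx_adj mul_scalar_mx.
have By_alt : alternating (B *m y).
  rewrite By; split=> [i|i j ij]; first by rewrite mxE mulf_neq0 ?a_alt.1 // lt0r_neq0.
  by rewrite !mxE mulrACA pmulr_rlt0 ?mulr_gt0 //; apply: a_alt.2.
have By_neq0 : B *m y != 0.
  by apply/eqP => By0; have := By_alt.1 ord0; rewrite By0 mxE eqxx.
rewrite sign_changes_alternating // in le_y eq_y.
have y_full : sign_changes y = r.+1.
  apply/eqP; rewrite eqn_leq le_y andbT.
  apply: leq_trans (changes_size _) _; rewrite size_filter -subn1.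
  apply: leq_trans (leq_sub2r 1 (count_size _ _)) _.
  by rewrite size_map size_enum_ord subn1.
have [first_eq _] := eq_y (esym y_full) By_neq0.
have y0_eq : first_nonzero y = y ord0 0 by apply: first_nonzero_full.
rewrite first_nonzero_alternating // y0_eq By mxE sgrM gtr0_sg // mul1r in first_eq.
have : 0 < y ord0 0 * a ord0 0.
  by rewrite -sgr_cp0 sgrM -first_eq -expr2 sqr_sg a_alt.1.
rewrite ltNge => /negP; apply; rewrite mxE mulr_suml.
by apply: sumr_le0 => i _; rewrite mxE; apply: cofactor_alternating_le0.
Qed.

End Criterion.

Theorem theorem5p3 (R : realType) (m n : nat) (A : 'M[R]_(m, n))
    (hm : (2 <= m)%N) (hn : (2 <= n)%N)
    (hA : forall (i : 'I_m) (j : 'I_n), A i j <= 0) :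
  [<-> totally_nonpositive A;
       forall x : 'cV[R]_n, has_both_signs x -> variation_diminished A x;
       forall (r : nat) (f : 'I_r -> 'I_m) (g : 'I_r -> 'I_n),
         (2 <= r <= minn m n)%N -> increasing f -> increasing g ->
         exists2 a : 'cV[R]_r, alternating a &
           variation_diminished (mxsub f g A) (\adj (mxsub f g A) *m a)].
Proof.
tfae.
- by move=> A_tnp x; apply: tnp_variation_diminished.
- move=> A_var [|[|r]] f g //= _ f_incr g_incr.
  exists (\col_i (-1) ^+ i); first exact: alternating_signs.
  apply: variation_diminished_adj => [||i j]; last by rewrite mxE.
    exact: alternating_signs.
  set y := _ *m _ => -[[i yi_gt0] [j yj_lt0]].
  apply: variation_diminished_extension => //; apply: A_var.
  have x_coord k : (colsub g 1%:M *m y) (g k) 0 = y k 0.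
    exact: extension_coord.
  by split; [exists (g i) | exists (g j)]; rewrite x_coord.
move=> A_adj r; elim: r => [|[|r] IHr] f g //= le_r f_incr g_incr.
  by rewrite det_mx11 mxE.
have [a a_alt a_var] := A_adj _ f g le_r f_incr g_incr.
apply: det_le0_of_variation_adj a_alt a_var => i.
rewrite row'Esub col'Esub -!mxsub_comp; apply: IHr.
- by lia.
- by apply: increasing_comp => //; apply: increasing_lift.
- by apply: increasing_comp => //; apply: increasing_lift.
Qed.
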